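(* Suppose that the randomized forward map $\mathcal G_h$ has mean-square order of convergence $s>0$ with respect to the prior $\mu_0$, and that the boundedness assumption (i)--(iv) stated in the context holds. Let $\mu_{h,\mathrm a}$ be the averaged posterior and $\mu_{h,\mathrm a}^M$ its Monte Carlo approximation. Then there is a constant $C>0$ independent of $h$ and $M$ such that $$\sqrt{\mathbb E^{\nu_h}\left[d_{\mathrm H}\left(\mu_{h,\mathrm a},\mu_{h,\mathrm a}^M\right)^2\right]}\le C\,\frac{h^s}{\sqrt M}.$$
   Context: Setting. $X$ and $Y$ are Banach spaces with their Borel $\sigma$-algebras, $\dim Y<\infty$; $\mathcal G\colon X\to Y$ is a (measurable) forward map; $y\in Y$ is a fixed observation; $\Gamma$ is a non-singular covariance on $Y$; $\mu_0=\mathcal N(m_0,C_0)$ is a Gaussian prior on $X$ with $m_0 \in X$ and trace-class covariance operator $C_0$. For each $h>0$, $\mathcal G_h\colon\Omega\times X\to Y$ is a random (measurable) forward map, where $(\Omega,\mathcal A)$ is a measurable space, $\nu_h$ is a probability measure on $\Omega$ giving the distribution of the first argument of $\mathcal G_h$, and the randomness of the two arguments is independent. $\mathbb E^{\nu_h}$ and $\mathbb E^{\mu_0}$ denote expectation with respect to $\nu_h$ and $\mu_0$. Set $$\Phi(u)=\tfrac12\|\Gamma^{-1/2}(y-\mathcal G(u))\|_Y^2,\quad Z=\int_X e^{-\Phi(u)}\,d\mu_0(u),\quad \Phi_h(\omega,u)=\tfrac12\|\Gamma^{-1/2}(y-\mathcal G_h(\omega,u))\|_Y^2,\quad Z_h(\omega)=\int_X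 e^{-\Phi_h(\omega,u)}\,d\mu_0(u).$$ The dependence on $\omega$ is usually omitted. Mean-square order. $\mathcal G_h$ has mean-square order of convergence $s>0$ with respect to $\mu_0$ if there is a constant $C>0$ independent of $h$ such that $\mathbb E^{\nu_h}\left[\|\mathcal G(u)-\mathcal G_h(\cdot,u)\|_Y^2\right]^{1/2}\le Ch^s$, $\mu_0$-a.s. in $u$. Monte Carlo quantities. For a positive integer $M$, let $\Phi_h^{(1)},\dots,\Phi_h^{(M)}$ be i.i.d. copies of the random function $\Phi_h$ (i.e. $\Phi_h^{(i)}(u)=\Phi_h(\omega_i,u)$ with $\omega_i$ i.i.d. of law $\nu_h$), and set $\exp^M(\pm\Phi_h(u))=\frac1M\sum_{i=1}^M\exp(\pm\Phi_h^{(i)}(u))$, $Z_h^{(i)}=\int_X\exp(-\Phi_h^{(i)}(u))\,d\mu_0(u)$, $Z_h^M=\frac1M\sum_{i=1}^M Z_h^{(i)}$. By abuse of notation, $\mathbb E^{\nu_h}$ also denotes expectation over the sample draws, and ''$\nu_h$-a.s.'' also means almost surely with respect to these draws. Measures. The averaged posterior $\mu_{h,\mathrm a}$ and its (random) Monte Carlo approximation $\mu_{h,\mathrm a}^M$ are defined by $$\frac{d\mu_{h,\mathrm a}}{d\mu_0}(u)=\mathbb E^{\nu_h}\left[\frac{\exp(-\Phi_h(u))}{Z_h}\right],\qquad \mu_{h,\mathrm a}^M(du)=\frac1M\sum_{i=1}^M\mu_{h,\mathrm s}^{(i)}(du),\qquad \frac{d\mu_{h,\mathrm s}^{(i)}}{d\mu_0}(u)=\frac{\exp(-\Phi_h^{(i)}(u))}{Z_h^{(i)}}.$$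 Hellinger distance: for $\mu,\nu$ absolutely continuous with respect to a reference probability measure $\lambda$, $d_{\mathrm H}(\mu,\nu)^2=\frac12\int_X\left(\sqrt{d\mu/d\lambda}-\sqrt{d\nu/d\lambda}\right)^2d\lambda$. Boundedness assumption. There are constants $C_1,\dots,C_4>0$ independent of $h$ and $M$ such that: (i) $\min\left\{\mathbb E^{\nu_h}\left[\|\exp(\Phi_h)\|_{L^\infty_{\mu_0}(X)}\right],\ \|\exp^M(\Phi_h)\|_{L^\infty_{\mu_0}(X)}\right\}\le C_1$, $\nu_h$-a.s.; (ii) $C_2^{-1}\le Z\le C_2$; (iii) $C_3^{-1}\le Z_h\le C_3$, $\nu_h$-a.s.; (iv) $C_4^{-1}\le Z_h^M\le C_4$, $\nu_h$-a.s. *)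

(* Defs.v *)
From HB Require Import structures.
From mathcomp Require Import all_boot all_order all_algebra sesquilinear.
From mathcomp Require Import all_classical all_reals all_analysis.

Set Implicit Arguments.
Unset Strict Implicit.
Unset Printing Implicit Defensive.

Import Order.TTheory GRing.Theory Num.Theory.
Import numFieldNormedType.Exports.

Local Open Scope classical_set_scope.
Local Open Scope ring_scope.

Notation borel T := (g_sigma_algebraType (@open T)).

Section finite_dimension.
Context (R : realType) (Y : normedModType R).

Definition finite_dimensional : Prop :=
  exists (n : nat) (e : 'I_n -> Y),
    forall y : Y, exists c : 'I_n -> R, y = \sum_(i < n) c i *: e i.

Variable ip : {dot Y for idfun}.

(* Y need not be Euclidean for its own norm, so self-adjointness of operators on
   Y refers to an inner product ip that need not induce the norm of Y. *)
Definition covariance_op (Gam : {linear Y -> Y}) : Prop :=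
  (forall x y, ip (Gam x) y = ip x (Gam y)) /\ (forall x, 0 <= ip (Gam x) x).

Definition inverse_sqrt_op (Gam S : {linear Y -> Y}) : Prop :=
  exists T : {linear Y -> Y},
    [/\ covariance_op T, forall y, T (T y) = Gam y, cancel T S & cancel S T].

End finite_dimension.

Section gaussian.
Context (R : realType) (X : normedModType R).

(* The topological dual of X, as a set of functions. *)
Definition dual : set (X -> R) :=
  [set f | scalar (f : X -> R^o) /\ continuous (f : X -> R^o)].

Definition linear_on_dual (V : lmodType R) (L : (X -> R) -> V) : Prop :=
  forall (a : R) (f g : X -> R), dual f -> dual g ->
    L (fun x => a * f x + g x) = a *: L f + L g.

(* On a Banach space "trace class" means nuclear: C0 = sum_n phi_n (x) v_n with
   phi_n in the bidual of X, v_n in X and sum_n |phi_n| |v_n| < +oo; b_n is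
   a bound of the norm of phi_n. On a Hilbert space this is the usual notion. *)
Definition trace_class (C0 : (X -> R) -> X) : Prop :=
  exists (phi : nat -> (X -> R) -> R^o) (b : nat -> R) (v : nat -> X),
    [/\ forall n, linear_on_dual (phi n),
        forall n, 0 <= b n,
        forall n f K, dual f -> (forall x, `|f x| <= K * `|x|) ->
          `|phi n f| <= b n * K,
        cvgn (series (fun n => b n * `|v n|)) &
        forall f, dual f -> series (fun n => phi n f *: v n) @ \oo --> C0 f].

(* Covariance operators on a Banach space map the dual of X to X. *)
Definition trace_class_covariance (C0 : (X -> R) -> X) : Prop :=
  [/\ linear_on_dual C0,
      forall f g, dual f -> dual g -> f (C0 g) = g (C0 f),
      forall f, dual f -> 0 <= f (C0 f) &
      trace_class C0].

(* N(m, v) with variance v; normal_prob takes the standard deviation, and is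
   not the Dirac mass when it is zero. *)
Definition normal_law (m v : R) : set R -> \bar R :=
  if v == 0 then \d_m else normal_prob m (Num.sqrt v).

Definition gaussian (mu : probability (borel X) R) (m0 : X)
    (C0 : (X -> R) -> X) : Prop :=
  trace_class_covariance C0 /\
  forall f, dual f -> forall A : set R, measurable A ->
    mu (f @^-1` A) = normal_law (f m0) (f (C0 f)) A.

End gaussian.

Section sample_law.
Context d (T : measurableType d) (R : realType).

Definition cons_sample (M : nat) (x : T * M.-tuple T) : M.+1.-tuple T :=
  [tuple of x.1 :: x.2].

Lemma measurable_cons_sample M : measurable_fun setT (@cons_sample M).
Proof. exact: measurable_cons. Qed.

HB.instance Definition _ M :=
  isMeasurableFun.Build _ _ _ _ (@cons_sample M) (@measurable_cons_sample M).

(* The M-fold product of nu: the law of M i.i.d. draws from nu. *)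
Fixpoint iid (nu : probability T R) (M : nat) : probability (M.-tuple T) R :=
  match M with
  | 0%N => \d_([tuple] : 0.-tuple T)
  | M'.+1 => distribution (nu \x iid nu M')%E (@cons_sample M')
  end.

End sample_law.

Lemma iid_box d (T : measurableType d) (R : realType) (nu : probability T R)
    (M : nat) (A : nat -> set T) :
  (forall i, measurable (A i)) ->
  iid nu M [set w | forall i : 'I_M, A i (tnth w i)] =
  (\prod_(i < M) nu (A i))%E.
Proof.
elim: M A => [|M IH] A mA.
  by rewrite big_ord0 /= diracE mem_set// => -[].
rewrite big_ord_recl /= /distribution /pushforward /=.
rewrite [X in (_ \x _)%E X](_ : _ =
    A 0%N `*` [set w | forall i : 'I_M, A i.+1 (tnth w i)]); last first.
  apply/seteqP; split => -[x w] /=.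
    move=> h; split; first by have := h ord0.
    by move=> i; have := h (lift ord0 i); rewrite tnthS.
  move=> -[hx hw] i; case: (unliftP ord0 i) => [j|] ->; last by [].
  by rewrite tnthS; exact: hw.
rewrite product_measure1E//.
  by congr (_ * _)%E; exact: (IH (fun i => A i.+1)).
rewrite [X in measurable X](_ : _ =
    \bigcap_(i in [set: 'I_M]) [set w : M.-tuple T | A i.+1 (tnth w i)]).
  apply: fin_bigcap_measurable => //.
  by move=> i _; rewrite -[X in measurable X]setTI; exact: measurable_tnth.
by apply/seteqP; split => w /= h i => [_|]; exact: h.
Qed.

Section monte_carlo.
Context d d' (T : measurableType d) (U : measurableType d') (R : realType).
Context (M : nat).

Definition sample_mean (f : T -> R) (w : M.-tuple T) : R :=
  M%:R^-1 * \sum_(i < M) f (tnth w i).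

Local Open Scope ereal_scope.

Definition average_measure (mu : T -> probability U R) (w : M.-tuple T)
    (A : set U) : \bar R :=
  (M%:R^-1)%:E * \sum_(i < M) mu (tnth w i) A.

Variables (mu : T -> probability U R) (w : M.-tuple T).
Local Notation avg := (average_measure mu w).

Let avg0 : avg set0 = 0.
Proof. by rewrite /average_measure big1 ?mule0. Qed.

Let avg_ge0 A : 0 <= avg A.
Proof. by rewrite mule_ge0 ?lee_fin// sume_ge0. Qed.

Let avg_sigma_additive : semi_sigma_additive avg.
Proof.
move=> F mF tF mUF.
pose m : {measure set U -> \bar R}^nat :=
  fun k => if insub k is Some i then mu (tnth w i) else mzero.
have avgE A : avg A = mscale (M%:R^-1)%:nng%R (msum m M) A.
  rewrite /mscale /msum /=; congr (_ * _); apply: eq_bigr => i _.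
  by rewrite /m insubT//= => p; congr (mu (tnth w _) A); apply: val_inj.
rewrite avgE; under eq_fun do under eq_bigr do rewrite avgE.
exact: measure_semi_sigma_additive.
Qed.

HB.instance Definition _ :=
  isMeasure.Build _ _ _ avg avg0 avg_ge0 avg_sigma_additive.

Let avg_fin : fin_num_fun avg.
Proof.
move=> A mA; rewrite fin_numM//.
by apply/sum_fin_numP => i _ _; exact: fin_num_measure.
Qed.

HB.instance Definition _ := @Measure_isFinite.Build _ U _ avg avg_fin.

End monte_carlo.

Section densities.
Context d (T : measurableType d) (R : realType).
Variable lambda : probability T R.
Local Open Scope ereal_scope.
Local Open Scope charge_scope.

Definition has_density (mu : {finite_measure set T -> \bar R})
    (f : T -> \bar R) : Prop :=
  mu `<< lambda /\
  ae_eq lambda setT ('d (charge_of_finite_measure mu) '/d lambda) f.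

Definition hellinger (mu nu : {finite_measure set T -> \bar R}) : \bar R :=
  sqrte ((2^-1)%:E * \int[lambda]_u
    ((sqrte (('d (charge_of_finite_measure mu) '/d lambda) u) -
      sqrte (('d (charge_of_finite_measure nu) '/d lambda) u)) ^+ 2)).

End densities.

Section bayesian_inverse_problem.
Context (R : realType) (X Y : normedModType R).
Context d (Omega : measurableType d).
Variable mu0 : probability (borel X) R.

Definition potential (S : {linear Y -> Y}) (y : Y) (g : X -> Y) (u : X) : R :=
  2^-1 * `|S (y - g u)| ^+ 2.

Definition evidence (phi : X -> R) : R := \int[mu0]_u expR (- phi u).

Variable nu : R -> probability Omega R.

Definition mean_square_order (G : X -> Y) (Gh : R -> Omega -> X -> Y) (s : R)
    : Prop :=
  exists2 C : R, 0 < C & forall h, 0 < h ->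
    {ae mu0, forall u,
      (sqrte (\int[nu h]_w (`|G u - Gh h w u| ^+ 2)%:E) <= (C * h `^ s)%:E)%E}.

(* The expectation over w in the first bound does not depend on the draws ws. *)
Definition boundedness (Phi : X -> R) (Phih : R -> Omega -> X -> R) : Prop :=
  exists C1 C2 C3 C4 : R,
    [/\ [/\ 0 < C1, 0 < C2, 0 < C3 & 0 < C4],
        forall h M, 0 < h -> (0 < M)%N ->
          {ae iid (nu h) M, forall ws,
            (Order.min
              (\int[nu h]_w 'N[mu0]_+oo[(fun u => (expR (Phih h w u))%:E)])
              ('N[mu0]_+oo[(fun u =>
                (sample_mean (fun w => expR (Phih h w u)) ws)%:E)])
             <= C1%:E)%E},
        C2^-1 <= evidence Phi <= C2,
        forall h, 0 < h ->
          {ae nu h, forall w, C3^-1 <= evidence (Phih h w) <= C3} &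
        forall h M, 0 < h -> (0 < M)%N ->
          {ae iid (nu h) M, forall ws,
            C4^-1 <= sample_mean (fun w => evidence (Phih h w)) ws <= C4}].

End bayesian_inverse_problem.

(* Main.v *)
Require Import Defs.
From mathcomp Require Import all_boot all_order all_algebra sesquilinear.
From mathcomp Require Import all_classical all_reals all_analysis.
From mathcomp Require Import measurable_realfun ess_sup_inf ring lra.

(** Let [p(w, u) = exp (- Phi_h(w, u)) / Z_h(w)] be the posterior density of one
    draw. The averaged posterior has density [a(u) = E p(w, u)], and its Monte
    Carlo approximation has as density the sample mean [aM(u)] of the
    [p(w_i, u)].

    Hypothesis (i), by the inequality between harmonic and arithmetic means,
    bounds [a] or [aM] below by a constant ([density_lower_bound]); which of the
    two depends on which argument of the minimum is small, but either suffices
    for [(sqrt a - sqrt aM) ^ 2 <= c * (a - aM) ^ 2] ([sqrt_diff_sq_le]). The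
    squared Hellinger distance is therefore at most a multiple of the integral
    of [(a - aM) ^ 2] over the prior. For fixed [u] the expectation of
    [(a(u) - aM(u)) ^ 2] over the sample is [1 / M] times the variance of
    [p(., u)] ([sample_mean_variance]): this is the factor [1 / M].

    The factor [h ^ (2 s)] comes from bounding that variance by the mean-square
    distance of [p(., u)] to any deterministic number, here the exact posterior
    density [exp (- Phi(u)) / Z]. Numerator and evidence are compared separately
    ([density_mean_square_error]), and both differences are controlled by the
    difference of the likelihoods [exp (- Phi_h) - exp (- Phi)]. As
    [x |-> exp (- x ^ 2 / 2)] is Lipschitz and linear maps on the
    finite-dimensional space of observations are bounded
    ([finite_dimensional_linear_bounded]), this is at most a multiple of
    [|G - G_h|], whose mean square is [O(h ^ (2 s))] by hypothesis. *)

Set Implicit Arguments.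
Unset Strict Implicit.
Unset Printing Implicit Defensive.

Import Order.TTheory GRing.Theory Num.Theory.
Import numFieldNormedType.Exports.

Local Open Scope classical_set_scope.
Local Open Scope ring_scope.

(** * Two elementary inequalities *)

Section elementary.
Variable R : realType.
Implicit Types a b : R.

(** The derivative of [x |-> exp (- x ^ 2 / 2)] is bounded by [1]. The bound is
    obtained from [1 + x <= exp x] alone: for [b - a >= 1] both exponentials
    lie in [0, 1], and otherwise the tangent inequality at
    [(b ^ 2 - a ^ 2) / 2] suffices. *)
Lemma expR_half_sq_lipschitz a b : 0 <= a -> 0 <= b ->
  `|expR (- (2^-1 * a ^+ 2)) - expR (- (2^-1 * b ^+ 2))| <= `|a - b|.
Proof.
wlog ab : a b / a <= b => [H a0 b0|].
  by have [/H|/ltW/H] := leP a b; [|rewrite distrC (distrC a)]; exact.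
move=> a0 b0; have leab : expR (- (2^-1 * b ^+ 2)) <= expR (- (2^-1 * a ^+ 2)).
  by rewrite ler_expR; nra.
rewrite ger0_norm ?subr_ge0// distrC ger0_norm ?subr_ge0//.
set ea := expR (- (2^-1 * a ^+ 2)) in leab *.
have ea0 : 0 < ea by exact: expR_gt0.
have ea1 : ea * (1 + 2^-1 * a ^+ 2) <= 1.
  rewrite -ler_pdivlMl// mulr1 /ea expRN invrK.
  exact: expR_ge1Dx.
have eb : ea * (1 - 2^-1 * (b ^+ 2 - a ^+ 2)) <= expR (- (2^-1 * b ^+ 2)).
  rewrite (_ : - (2^-1 * b ^+ 2) =
    - (2^-1 * a ^+ 2) + - (2^-1 * (b ^+ 2 - a ^+ 2))); last by ring.
  by rewrite expRD ler_wpM2l ?(ltW ea0)//; exact: expR_ge1Dx.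
have eb0 : 0 < expR (- (2^-1 * b ^+ 2)) by exact: expR_gt0.
have ea_le1 : ea <= 1 by rewrite (le_trans _ ea1)// ler_peMr ?(ltW ea0)//; nra.
clearbody ea; move: (expR (- (2^-1 * b ^+ 2))) leab eb eb0 => eb leab ebge eb0.
have [ba1|ba1] := leP 1 (b - a); first by lra.
have : ea * (2^-1 * (a + b)) <= 1.
  apply: le_trans ea1; rewrite ler_wpM2l ?(ltW ea0)//.
  by have := sqr_ge0 (a - 1); nra.
nra.
Qed.

(** One of the two densities bounded below is enough, because the identity
    [a - b = (sqrt a - sqrt b) * (sqrt a + sqrt b)] only needs
    [k <= (sqrt a + sqrt b) ^ 2]. *)
Lemma sqrt_diff_sq_le (k a b : R) : 0 < k -> 0 <= a -> 0 <= b ->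
  k <= a \/ k <= b -> (Num.sqrt a - Num.sqrt b) ^+ 2 <= k^-1 * (a - b) ^+ 2.
Proof.
move=> k0 a0 b0 kab; rewrite mulrC ler_pdivlMr//.
rewrite -{2}(sqr_sqrtr a0) -{2}(sqr_sqrtr b0) subr_sqr exprMn.
rewrite ler_wpM2l ?sqr_ge0//.
have := sqrtr_ge0 a; have := sqrtr_ge0 b.
have := sqr_sqrtr a0; have := sqr_sqrtr b0.
by case: kab; nra.
Qed.

End elementary.

(** * Bounded random variables *)

Section bounded_random_variables.
Context d (T : measurableType d) (R : realType) (P : probability T R).

Lemma bounded_integrable (f : T -> R) (B : R) :
  measurable_fun setT f -> (forall x, `|f x| <= B) ->
  P.-integrable setT (EFin \o f).
Proof.
move=> mf fB; apply: measurable_bounded_integrable => //.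
  by rewrite (le_lt_trans (probability_le1 P _))// ltry.
exists B; split; first exact: num_real.
by move=> x Bx y _; exact: le_trans (fB y) (ltW Bx).
Qed.

Lemma Rintegral_EFin (f : T -> R) (B : R) :
  measurable_fun setT f -> (forall x, `|f x| <= B) ->
  (\int[P]_x (f x)%:E = (\int[P]_x f x)%R%:E)%E.
Proof.
move=> mf fB; rewrite fineK//; apply: integrable_fin_num => //.
exact: bounded_integrable mf fB.
Qed.

Lemma integral_probability_cst (c : \bar R) : (\int[P]__ c = c)%E.
Proof.
by rewrite integral_cst// -[RHS]mule1 -(probability_setT P).
Qed.

(** The bias-variance decomposition, from which the variance of the sample
    mean and the square-mean inequality are both read off. *)
Lemma integral_sq_shift (f : T -> R) (B s : R) :
  measurable_fun setT f -> (forall x, `|f x| <= B) ->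
  (\int[P]_x ((f x + s) ^+ 2)%:E =
   \int[P]_x (f x ^+ 2)%:E + (2 * s * \int[P]_x f x + s ^+ 2)%R%:E)%E.
Proof.
move=> mf fB.
have mf2 : measurable_fun setT (fun x => f x ^+ 2) by exact: measurable_funX.
have if2 : P.-integrable setT (EFin \o (fun x => f x ^+ 2)).
  apply: (@bounded_integrable _ (B ^+ 2)) => // x.
  by rewrite normrX lerXn2r ?nnegrE// (le_trans _ (fB x)).
have iF := bounded_integrable mf fB.
under eq_integral => x _.
  rewrite (_ : (f x + s) ^+ 2 = f x ^+ 2 + (2 * s * f x + s ^+ 2));
    last by ring.
  rewrite EFinD [in X in (_ + X)%E]EFinD [in X in (_ + (X + _))%E]EFinM.
over.
rewrite /= integralD//; last first.
  apply: integrableD => //=; first exact: integrableZl.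
  exact: finite_measure_integrable_cst.
congr (_ + _)%E; rewrite integralD//; last 2 first.
- exact: integrableZl.
- exact: finite_measure_integrable_cst.
rewrite integralZl// (Rintegral_EFin mf fB) -EFinM [in RHS]EFinD.
congr (_ + _)%E.
exact: integral_probability_cst.
Qed.

End bounded_random_variables.

Section means.
Context d (T : measurableType d) (R : realType) (P : probability T R).

Lemma sq_Rintegral_le (f : T -> R) (B : R) :
  measurable_fun setT f -> (forall x, `|f x| <= B) ->
  (((\int[P]_x f x) ^+ 2)%R%:E <= \int[P]_x (f x ^+ 2)%:E)%E.
Proof.
move=> mf fB; set m := \int[P]_x f x.
have := integral_sq_shift P (- m) mf fB; rewrite -/m.
rewrite (_ : 2 * - m * m + (- m) ^+ 2 = - (m ^+ 2)); last by ring.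
move=> H; rewrite -sube_ge0// -EFinN -H.
by apply: integral_ge0 => x _; rewrite lee_fin sqr_ge0.
Qed.

(** Nonnegativity allows writing the inverse as the power of exponent [-1]. *)
Lemma measurable_inv_ge0 (f : T -> R) : measurable_fun setT f ->
  (forall x, 0 <= f x) -> measurable_fun setT (fun x => (f x)^-1).
Proof.
move=> mf f0; under eq_fun do rewrite -powR_inv1//.
exact: measurableT_comp (measurable_powR _) mf.
Qed.

(** The tangent line of [x |-> 1 / x] at [1 / c], rescaled. Integrating it
    yields the harmonic-arithmetic mean inequality without any division by a
    mean. *)
Let tangent (c x : R) : 0 < c -> 0 < x -> 2 * c^-1 <= x + c^-1 ^+ 2 * x^-1.
Proof.
move=> c0 x0; rewrite -subr_ge0.
rewrite (_ : _ - _ = (x - c^-1) ^+ 2 * x^-1).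
  by rewrite mulr_ge0 ?sqr_ge0// invr_ge0 ltW.
by field; rewrite !gt_eqF.
Qed.

Lemma Rintegral_ge_of_inv (f : T -> R) (c : R) : 0 < c ->
  measurable_fun setT f -> (forall x, 0 < f x <= 1) ->
  (\int[P]_x ((f x)^-1)%:E <= c%:E)%E -> c^-1 <= \int[P]_x f x.
Proof.
move=> c0 mf f01 fc.
have fpos x : 0 < f x by case/andP: (f01 x).
have fB x : `|f x| <= 1 by rewrite gtr0_norm//; case/andP: (f01 x).
have mfV : measurable_fun setT (fun x => (f x)^-1).
  by apply: measurable_inv_ge0 => // x; exact: ltW.
have : ((2 * c^-1)%:E <= (\int[P]_x f x)%:E + (c^-1)%:E)%E.
  rewrite -(integral_probability_cst P (2 * c^-1)%:E).
  apply: (@le_trans _ _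
    (\int[P]_x ((f x)%:E + (c^-1 ^+ 2)%:E * ((f x)^-1)%:E))%E).
    apply: ge0_le_integral => //=.
    - by move=> x _; rewrite lee_fin mulr_ge0// invr_ge0 ltW.
    - apply: emeasurable_funD; first exact/measurable_EFinP.
      by apply: measurable_funeM; exact/measurable_EFinP.
    - by move=> x _; rewrite -EFinM -EFinD lee_fin tangent.
  rewrite ge0_integralD//; last 4 first.
  - by move=> x _; rewrite lee_fin ltW.
  - exact/measurable_EFinP.
  - by move=> x _; rewrite -EFinM lee_fin mulr_ge0 ?sqr_ge0// invr_ge0 ltW.
  - by apply: measurable_funeM; exact/measurable_EFinP.
  rewrite (Rintegral_EFin P mf fB) leeD2l// ge0_integralZl_EFin ?sqr_ge0//;
    last 2 first.
  - by move=> x _; rewrite lee_fin invr_ge0 ltW.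
  - exact/measurable_EFinP.
  rewrite (@le_trans _ _ ((c^-1 ^+ 2)%:E * c%:E)%E)//.
    by rewrite lee_wpmul2l// lee_fin sqr_ge0.
  by rewrite -EFinM lee_fin expr2 -mulrA mulVf ?gt_eqF// mulr1.
by rewrite -EFinD lee_fin; lra.
Qed.

Lemma sample_mean_ge_of_inv (f : T -> R) (c : R) (M : nat) (ws : M.-tuple T) :
  (0 < M)%N -> 0 < c -> (forall x, 0 < f x) ->
  sample_mean (fun x => (f x)^-1) ws <= c -> c^-1 <= sample_mean f ws.
Proof.
move=> M0 c0 f0 fc.
have Mn0 : 0 < M%:R :> R by rewrite ltr0n.
have : 2 * c^-1 <=
    sample_mean f ws + c^-1 ^+ 2 * sample_mean (fun x => (f x)^-1) ws.
  rewrite /sample_mean mulrCA -mulrDr mulr_sumr -big_split /=.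
  rewrite [leRHS]mulrC ler_pdivlMr//.
  rewrite (_ : _ * M%:R = \sum_(i < M) (2 * c^-1)); last first.
    by rewrite sumr_const card_ord mulr_natr.
  by apply: ler_sum => i _; exact: tangent.
have : c^-1 ^+ 2 * sample_mean (fun x => (f x)^-1) ws <= c^-1.
  rewrite (@le_trans _ _ (c^-1 ^+ 2 * c))//.
    by rewrite ler_wpM2l ?sqr_ge0.
  by rewrite expr2 -mulrA mulVf ?gt_eqF// mulr1.
by lra.
Qed.

End means.

(** * Independent samples *)

Section iid_sample.
Context d (T : measurableType d) (R : realType) (P : probability T R).

(** Cross terms vanish one draw at a time: with the other draws fixed, their sum
    is a constant, and [integral_sq_shift] applied to the first draw has no
    linear term. *)
Lemma iid_second_moment (f : T -> R) (B : R) (M : nat) :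
  measurable_fun setT f -> (forall x, `|f x| <= B) -> \int[P]_x f x = 0 ->
  (\int[iid P M]_ws ((\sum_(i < M) f (tnth ws i)) ^+ 2)%:E =
   M%:R%:E * \int[P]_x (f x ^+ 2)%:E)%E.
Proof.
move=> mf fB f0.
have mS n : measurable_fun setT
    (fun ws : n.-tuple T => \sum_(i < n) f (tnth ws i)).
  apply: measurable_sum => i; apply: measurableT_comp => //.
  exact: measurable_tnth.
have mSe n : measurable_fun setT
    (fun ws : n.-tuple T => ((\sum_(i < n) f (tnth ws i)) ^+ 2)%:E).
  by apply/measurable_EFinP; exact: (measurable_funX _ (mS n)).
have S0 n (ws : n.-tuple T) : (0 <= ((\sum_(i < n) f (tnth ws i)) ^+ 2)%:E)%E.
  by rewrite lee_fin sqr_ge0.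
have if0 : (0 <= \int[P]_x (f x ^+ 2)%:E)%E.
  by apply: integral_ge0 => x _; rewrite lee_fin sqr_ge0.
elim: M => [|M IH].
  rewrite mul0e; apply: integral0_eq => ws _.
  by rewrite big_ord0 expr0n.
rewrite /= ge0_integral_distribution; [|exact: mSe|exact: S0].
under eq_integral => x _.
  rewrite /= big_ord_recl /=.
  rewrite (_ : tnth (cons_sample x) ord0 = x.1)//.
  under eq_bigr => i _ do
    rewrite (_ : tnth (cons_sample x) (lift ord0 i) = tnth x.2 i) ?tnthS//.
over.
(* The first draw is integrated first, so that its zero mean can be used. *)
rewrite /= (@fubini_tonelli2 _ _ _ _ _ P (iid P M)
  (fun x => ((f x.1 + \sum_(i < M) f (tnth x.2 i)) ^+ 2)%:E))//=; last 2 first.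
- apply/measurable_EFinP; apply: measurable_funX; apply: measurable_funD.
    exact: measurableT_comp.
  exact: (@measurableT_comp _ _ _ _ _ _ _ _ (@snd T (M.-tuple T)) (mS M)).
- by move=> x; rewrite lee_fin sqr_ge0.
rewrite /fubini_G /=.
under eq_integral => ws _ do
  rewrite (integral_sq_shift _ _ mf fB) f0 mulr0 add0r.
rewrite ge0_integralD; [|by []|by []|exact: measurable_cst|
  by move=> ws _; exact: S0|exact: mSe].
rewrite integral_probability_cst IH.
rewrite -{1}(mul1e (\int[P]_x (f x ^+ 2)%:E)%E) -ge0_muleDl//.
by rewrite -EFinD -natr1 addrC.
Qed.

(** The mean minimizes the mean-square distance to a constant, so the variance
    may be replaced by the distance to any [c]. This freedom brings in the
    discretization error: [c] will be a value of the exact posterior density. *)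
Lemma sample_mean_variance (f : T -> R) (B c : R) (M : nat) : (0 < M)%N ->
  measurable_fun setT f -> (forall x, `|f x| <= B) ->
  (\int[iid P M]_ws ((\int[P]_x f x - sample_mean f ws) ^+ 2)%R%:E <=
   M%:R^-1%:E * \int[P]_x ((f x - c) ^+ 2)%:E)%E.
Proof.
move=> M0 mf fB; set m := \int[P]_x f x.
have Mn0 : M%:R != 0 :> R by rewrite pnatr_eq0 -lt0n.
have mg : measurable_fun setT (fun x => f x - m) by exact: measurable_funB.
have gB x : `|f x - m| <= B + `|m|.
  by rewrite (le_trans (ler_normB _ _))// lerD.
have g0 : \int[P]_x (f x - m) = 0.
  rewrite RintegralB//; last 2 first.
  - exact: bounded_integrable mf fB.
  - exact: finite_measure_integrable_cst.
  by rewrite /m [X in _ - X]/Rintegral integral_probability_cst subrr.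
have E ws : (m - sample_mean f ws) ^+ 2 =
    M%:R^-1 ^+ 2 * (\sum_(i < M) (f (tnth ws i) - m)) ^+ 2.
  rewrite -exprMn sumrB sumr_const card_ord /sample_mean -(mulr_natl m M).
  by rewrite mulrBr (mulKf Mn0) -[RHS]sqrrN opprB.
under eq_integral => ws _ do rewrite E EFinM.
rewrite ge0_integralZl_EFin//; last 2 first.
- by move=> ws _; rewrite lee_fin sqr_ge0.
- apply/measurable_EFinP; apply: measurable_funX; apply: measurable_sum => i.
  apply: (@measurableT_comp _ _ _ _ _ _ (fun x => f x - m)) => //.
  exact: measurable_tnth.
rewrite (iid_second_moment _ mg gB g0) muleA -EFinM expr2 mulfVK//.
apply: lee_wpmul2l; first by rewrite lee_fin invr_ge0.
have cE x : f x - c = f x - m + (m - c) by rewrite addrA subrK.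
under [leRHS]eq_integral => x _ do rewrite cE.
rewrite (integral_sq_shift _ _ mg gB) g0 mulr0 add0r.
by apply: leeDl; rewrite lee_fin sqr_ge0.
Qed.

(** The set of good draws has full measure, hence so does the box of samples all
    of whose draws are good. *)
Lemma ae_iid (Q : T -> Prop) (M : nat) :
  {ae P, forall x, Q x} -> {ae iid P M, forall ws, forall i, Q (tnth ws i)}.
Proof.
move=> [N [mN N0 QN]].
pose A := [set w : M.-tuple T | forall i, (~` N) (tnth w i)].
have mA : measurable A.
  rewrite (_ : A = \bigcap_(i in [set: 'I_M]) [set w | (~` N) (tnth w i)]).
    apply: fin_bigcap_measurable => // i _.
    rewrite -[X in measurable X]setTI; apply: measurable_tnth => //.
    exact: measurableC.
  by apply/seteqP; split => w h i; [move=> _|]; exact: h.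
exists (~` A); split; first exact: measurableC.
  rewrite probability_setC// [X in (_ - X)%E](iid_box P M (A := fun=> ~` N));
    last first.
    by move=> _; exact: measurableC.
  rewrite big1 ?subee// => i _.
  by rewrite probability_setC// N0 sube0.
move=> w /= nQ Aw; apply: nQ => i; apply: contrapT => nQ.
exact: (Aw i (QN _ nQ)).
Qed.

End iid_sample.

(** * Linear maps on finite-dimensional spaces *)

Section finite_dimension_bounded.
Variables (R : realType) (Y : normedModType R).

Definition spanning n (e : 'I_n -> Y) :=
  forall y : Y, exists c : 'I_n -> R, y = \sum_(i < n) c i *: e i.

(** A spanning family of least cardinality is free: a vanishing combination with
    a nonzero coefficient would let one of its vectors be discarded. *)
Lemma exists_basis : finite_dimensional Y ->
  exists n (e : 'I_n -> Y), spanning e /\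
    forall c : 'I_n -> R, \sum_(i < n) c i *: e i = 0 -> forall i, c i = 0.
Proof.
move=> fdY; pose p n := `[< exists e : 'I_n -> Y, spanning e >].
have exp : exists n, p n.
  by have [n [e he]] := fdY; exists n; apply/asboolP; exists e.
case: (ex_minnP exp) => n /asboolP[e he] nmin; exists n, e; split=> // c c0 i.
apply: contrapT => /eqP ci0.
case: n e he nmin c c0 i ci0 => [e he nmin c c0 []//|n e he nmin c c0 i ci0].
suff : (n.+1 <= n)%N by rewrite ltnn.
apply: nmin; apply/asboolP; exists (fun j => e (lift i j)) => y.
have [b yb] := he y.
exists (fun j => b (lift i j) - b i / c i * c (lift i j)).
transitivity (y - (b i / c i) *: \sum_(i < n.+1) c i *: e i).
  by rewrite c0 scaler0 subr0.
rewrite yb scaler_sumr -sumrB (bigD1_ord i)//= scalerA divfK// subrr add0r.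
by apply: eq_bigr => j _; rewrite scalerBl scalerA.
Qed.

Lemma linear_combination_continuous n (e : 'I_n -> Y) :
  continuous (fun v : 'rV[R]_n => \sum_(i < n) v ord0 i *: e i).
Proof.
apply: continuous_big => [|i _ v]; first exact: add_continuous.
have h : (fun w : 'rV[R]_n => w ord0 i) @ v --> v ord0 i.
  exact: coord_continuous.
exact: (cvgZr_tmp (a := e i) h).
Qed.

(** In a basis, the norm of a combination attains a positive minimum on the
    compact unit sphere of coordinates, so it dominates the norm of the
    coordinates, which in turn controls the image by any linear map. *)
Lemma finite_dimensional_linear_bounded (S : {linear Y -> Y}) :
  finite_dimensional Y -> exists2 K : R, 0 < K & forall y, `|S y| <= K * `|y|.
Proof.
move=> /exists_basis[[|n] [e [he free]]].
  exists 1 => // y; have [c ->] := he y.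
  by rewrite big_ord0 linear0 normr0 mulr0.
pose phi (v : 'rV[R]_n.+1) := \sum_(i < n.+1) v ord0 i *: e i.
pose sph := [set v : 'rV[R]_n.+1 | `|v| = 1].
have csph : compact sph.
  apply: bounded_closed_compact.
    by exists 1; split; [exact: num_real|move=> x x1 v /= ->; exact: ltW].
  apply: (@closed_comp _ _ (fun v : 'rV[R]_n.+1 => `|v|) [set 1]) => //.
  by move=> v _; exact: norm_continuous.
have sph0 : sph !=set0.
  exists (const_mx 1); rewrite /sph /= /Num.norm /= mx_normrE.
  apply/eqP; rewrite eq_le; apply/andP; split.
    by apply/bigmax_leP; split=> // -[i j] _; rewrite mxE normr1.
  by apply/bigmax_geP; right; exists (ord0, ord0) => //=; rewrite mxE normr1.
have cphi : {within sph, continuous (fun v => `|phi v|)}.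
  apply: continuous_subspaceT => v; apply: (continuous_comp (f := phi)).
    exact: linear_combination_continuous.
  exact: norm_continuous.
have [v0 v0S minv] := EVT_min_rV sph0 csph cphi.
have phi_gt0 : 0 < `|phi v0|.
  rewrite normr_gt0; apply/eqP => phi0.
  move: v0S; rewrite inE /sph /= (_ : v0 = 0) ?normr0.
    by move=> /esym/eqP; rewrite oner_eq0.
  by apply/rowP => i; rewrite mxE; exact: (free (fun i => v0 ord0 i)).
have phi_ge v : `|phi v0| * `|v| <= `|phi v|.
  have [->|v_neq0] := eqVneq v 0; first by rewrite normr0 mulr0.
  have nv : 0 < `|v| by rewrite normr_gt0.
  rewrite -ler_pdivlMr// mulrC -[X in X * _]gtr0_norm ?invr_gt0// -normrZ.
  rewrite [X in _ <= `|X|](_ : _ = phi (`|v|^-1 *: v)).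
    apply: minv; rewrite inE /sph /= normrZ gtr0_norm ?invr_gt0//.
    by rewrite mulVf// gt_eqF.
  by rewrite /phi scaler_sumr; apply: eq_bigr => i _; rewrite scalerA mxE.
pose L := 1 + \sum_(i < n.+1) `|S (e i)|.
have L0 : 0 < L by rewrite ltr_pwDl// sumr_ge0.
exists (L / `|phi v0|); first by rewrite divr_gt0.
move=> y; have [c yc] := he y; pose v := \row_i c i.
have yv : y = phi v by rewrite yc; apply: eq_bigr => i _; rewrite mxE.
rewrite -mulrA (@le_trans _ _ (L * `|v|))//; last first.
  by rewrite ler_wpM2l ?(ltW L0)// mulrC ler_pdivlMr// mulrC yv.
rewrite yv /phi linear_sum (le_trans (ler_norm_sum _ _ _))//.
rewrite /L mulrDl mul1r ler_wpDl// mulr_suml ler_sum// => i _.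
rewrite linearZ /= normrZ mulrC ler_wpM2l//.
rewrite [leRHS]/Num.norm /= mx_normrE; apply/bigmax_geP; right => /=.
by exists (ord0, i).
Qed.

End finite_dimension_bounded.

(** * Hellinger distance and densities *)

Section densities.
Context d (T : measurableType d) (R : realType).
Variable lambda : probability T R.

Lemma measurable_fun_sqrt d' (S : measurableType d') (f : S -> R) :
  measurable_fun setT f -> measurable_fun setT (fun x => Num.sqrt (f x)).
Proof.
apply: measurableT_comp; apply: continuous_measurable_fun.
exact: sqrt_continuous.
Qed.

Local Open Scope ereal_scope.
Local Open Scope charge_scope.

Lemma has_density_integral (mu : {finite_measure set T -> \bar R}) f A :
  has_density lambda mu f -> measurable_fun setT f -> measurable A ->
  mu A = \int[lambda]_(u in A) f u.
Proof.
move=> [mul muf] mf mA.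
have -> : mu A =
    \int[lambda]_(u in A) 'd (charge_of_finite_measure mu) '/d lambda u.
  exact: (@Radon_Nikodym_integral _ _ _ (charge_of_finite_measure mu) lambda).
apply: ae_eq_integral => //.
- exact: measurable_funTS.
- exact: measurable_funTS.
- exact: (ae_eq_subset _ muf).
Qed.

Lemma has_density_intro (mu : {finite_measure set T -> \bar R}) f :
  measurable_fun setT f ->
  (forall A, measurable A -> mu A = \int[lambda]_(u in A) f u) ->
  has_density lambda mu f.
Proof.
move=> mf muf; have mul : mu `<< lambda.
  apply/null_content_dominatesP => A mA A0.
  by rewrite muf//; apply: null_set_integral => //; exact: measurable_funTS.
split=> //; apply: integral_ae_eq => //.
  exact: (@Radon_Nikodym_integrable _ _ _ (charge_of_finite_measure mu) lambda).
move=> A _ mA; rewrite -muf//; symmetry.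
exact: (@Radon_Nikodym_integral _ _ _ (charge_of_finite_measure mu) lambda).
Qed.

(** Radon-Nikodym derivatives are only determined almost everywhere; they enter
    the Hellinger distance through an integral, so any representatives of the
    two densities compute it. *)
Lemma hellinger_has_density (mu nu : {finite_measure set T -> \bar R})
    (f g : T -> R) :
  measurable_fun setT f -> measurable_fun setT g ->
  has_density lambda mu (EFin \o f) -> has_density lambda nu (EFin \o g) ->
  hellinger lambda mu nu ^+ 2 =
  2^-1%:E * \int[lambda]_u ((Num.sqrt (f u) - Num.sqrt (g u)) ^+ 2)%:E.
Proof.
move=> mf mg [mul muf] [nul nug].
rewrite /hellinger.
set F := 'd _ '/d _; set G := 'd _ '/d _.
have mF : measurable_fun setT (fine \o F).
  apply: measurableT_comp => //; apply: measurable_int.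
  exact: (@Radon_Nikodym_integrable _ _ _ (charge_of_finite_measure mu) lambda).
have mG : measurable_fun setT (fine \o G).
  apply: measurableT_comp => //; apply: measurable_int.
  exact: (@Radon_Nikodym_integrable _ _ _ (charge_of_finite_measure nu) lambda).
have FE u : F u = (fine (F u))%:E by rewrite fineK// Radon_Nikodym_fin_num.
have GE u : G u = (fine (G u))%:E by rewrite fineK// Radon_Nikodym_fin_num.
have E u : (sqrte (F u) - sqrte (G u)) ^+ 2 =
    ((Num.sqrt (fine (F u)) - Num.sqrt (fine (G u))) ^+ 2)%:E.
  by rewrite FE GE.
under eq_integral => u _ do rewrite E.
rewrite sqr_sqrte; last first.
  rewrite mule_ge0 ?lee_fin ?invr_ge0//.
  by apply: integral_ge0 => u _; rewrite lee_fin sqr_ge0.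
congr (_ * _); apply: ae_eq_integral => //.
- apply/measurable_EFinP; apply: measurable_funX; apply: measurable_funB.
    exact: measurable_fun_sqrt.
  exact: measurable_fun_sqrt.
- apply/measurable_EFinP; apply: measurable_funX; apply: measurable_funB.
    exact: measurable_fun_sqrt.
  exact: measurable_fun_sqrt.
- apply: filterS2 muf nug => u /(_ I) + /(_ I) + _.
  by rewrite /F /G /= => -> ->.
Qed.

Lemma average_has_density d' (Om : measurableType d')
    (mu : Om -> probability T R) (p : Om -> T -> R) (M : nat)
    (ws : M.-tuple Om) :
  (forall w u, (0 <= p w u)%R) -> (forall w, measurable_fun setT (p w)) ->
  (forall w, has_density lambda (mu w) (EFin \o p w)) ->
  has_density lambda (average_measure mu ws)
    (fun u => (sample_mean (fun w => p w u) ws)%:E).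
Proof.
move=> p0 mp pd; have msum : measurable_fun setT
    (fun u => \sum_(i < M) p (tnth ws i) u)%R.
  exact: measurable_sum.
apply: has_density_intro.
  by apply/measurable_EFinP; apply: measurable_funM.
move=> A mA; rewrite /= /average_measure /sample_mean.
under [RHS]eq_integral => u _ do rewrite EFinM.
rewrite ge0_integralZl_EFin ?invr_ge0//; last 2 first.
- by move=> u _; rewrite lee_fin sumr_ge0.
- by apply/measurable_EFinP; exact: measurable_funTS.
congr (_ * _).
under [RHS]eq_integral => u _ do rewrite -sumEFin.
rewrite ge0_integral_sum//; last 2 first.
- by move=> i; apply/measurable_EFinP; exact: measurable_funTS.
- by move=> i u _; rewrite lee_fin.
apply: eq_bigr => i _; apply: (has_density_integral (pd _)) => //.
exact/measurable_EFinP.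
Qed.

End densities.

(** * Essential suprema of sections *)

Section essential_bounds.
Context d d' (Om : measurableType d) (U : measurableType d') (R : realType).
Context (P : probability Om R) (lambda : probability U R).
Local Open Scope ereal_scope.

Lemma Lnorm_infty_leP (f : U -> \bar R) y :
  'N[lambda]_+oo[f] <= y <-> {ae lambda, forall u, `|f u| <= y}.
Proof.
rewrite unlock /Lnorm ifT; last first.
  by rewrite [X in _ < X](_ : _ = 1) ?lte01//; exact: probability_setT.
by split=> [/ess_supP //|fy]; apply/ess_supP.
Qed.

(** The norm of the section at [w] exceeds [a] exactly when the section at [w]
    of [[set x | a < `|g x|]] has positive measure, and the measure of sections
    is a measurable function. *)
Lemma measurable_Lnorm_infty (g : Om * U -> R) : measurable_fun setT g ->
  measurable_fun setT (fun w => 'N[lambda]_+oo[(fun u => (g (w, u))%:E)]).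
Proof.
move=> mg; apply: (measurability _ (ErealGenOInfty.measurableE R)).
move=> /= _ [_ [a ->]] <-; rewrite setTI.
pose B := [set x | a%:E < `|(g x)%:E|].
have mB : measurable B.
  rewrite -[X in measurable X]setTI.
  apply: measurable_lte => //; apply: measurableT_comp => //.
  exact/measurable_EFinP.
have mf := measurable_fun_xsection lambda mB.
rewrite (_ : _ @^-1` _ = setT `&` [set w | (lambda \o xsection B) w != 0]).
  exact: emeasurable_neq.
rewrite setTI; apply/seteqP.
have aE w : 'N[lambda]_+oo[(fun u => (g (w, u))%:E)] <= a%:E <->
    lambda (xsection B w) = 0.
  rewrite Lnorm_infty_leP ae_le_measureP//; last first.
    apply: measurableT_comp => //; apply/measurable_EFinP.
    exact: measurable_fun_pair2.
  rewrite (_ : _ @^-1` _ = xsection B w)//.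
  apply/seteqP; split=> u; rewrite /xsection /B /= in_itv /= inE/= ?andbT.
    by rewrite lte_fin.
  by rewrite lte_fin.
split=> w /=; rewrite in_itv /= andbT.
  by move=> aN; apply/negP => /eqP/aE; rewrite leNgt aN.
by move=> B0; rewrite ltNge; apply/negP => /aE/eqP; exact/negP.
Qed.

(** Both conditions say that the complement of [A] is null for the product
    measure. *)
Lemma ae_section_swap (A : set (Om * U)) : measurable A ->
  {ae P, forall w, {ae lambda, forall u, A (w, u)}} ->
  {ae lambda, forall u, {ae P, forall w, A (w, u)}}.
Proof.
move=> mA aeA.
pose f (x : Om * U) : \bar R := (\1_(~` A) x)%:E.
have mf : measurable_fun setT f.
  by apply/measurable_EFinP; apply: measurable_indic; exact: measurableC.
have f0 x : 0 <= f x by rewrite lee_fin.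
have fA x : A x -> f x = 0.
  by move=> Ax; rewrite /f indicE memNset//; exact.
have Af x : f x = 0 -> A x.
  rewrite /f indicE => -[] /eqP; rewrite pnatr_eq0 eqb0 notin_setE /=.
  exact: contrapT.
have intf : \int[lambda]_u \int[P]_w f (w, u) = 0.
  rewrite -(fubini_tonelli f)// (ae_eq_integral (cst 0))//.
  - by rewrite integral0.
  - exact: measurable_fun_fubini_tonelli_F.
  apply: filterS aeA => w Aw _.
  rewrite (ae_eq_integral (cst 0)) ?integral0//.
    exact: measurable_fun_pair2.
  by apply: filterS Aw => u Awu _; exact: fA.
have : ae_eq lambda setT (fun u => \int[P]_w f (w, u)) (cst 0).
  apply/ae_eq_integral_abs => //.
    exact: measurable_fun_fubini_tonelli_G.
  rewrite -[RHS]intf; apply: eq_integral => u _.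
  by rewrite gee0_abs// integral_ge0.
apply: filterS => u /(_ I) /= fu.
have : ae_eq P setT (fun w => f (w, u)) (cst 0).
  apply/ae_eq_integral_abs => //; first exact: measurable_fun_pair1.
  by rewrite -[RHS]fu; apply: eq_integral => w _; rewrite gee0_abs.
by apply: filterS => w /(_ I) /= /Af.
Qed.

(** The null set of points [v] where [g (w, v)] exceeds its essential supremum
    depends on [w]; exchanging the two almost-everywhere quantifiers gives a
    null set of points [u] outside which the bound holds for almost all [w]. *)
Lemma ae_integral_le_Lnorm_infty (g : Om * U -> R) :
  measurable_fun setT g -> (forall x, 0 <= g x)%R ->
  {ae lambda, forall u, \int[P]_w (g (w, u))%:E <=
    \int[P]_w 'N[lambda]_+oo[(fun v => (g (w, v))%:E)]}.
Proof.
move=> mg g0; have mN := measurable_Lnorm_infty mg.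
pose A := [set x | (g x)%:E <= 'N[lambda]_+oo[(fun v => (g (x.1, v))%:E)]].
have mA : measurable A.
  rewrite -[A]setTI; apply: measurable_lee => //; first exact/measurable_EFinP.
  exact: (measurableT_comp mN measurable_fst).
have aeA : {ae P, forall w, {ae lambda, forall u, A (w, u)}}.
  apply: aeW => w.
  have /Lnorm_infty_leP := lexx ('N[lambda]_+oo[(fun u => (g (w, u))%:E)]).
  by apply: filterS => u; rewrite gee0_abs ?lee_fin.
apply: filterS (ae_section_swap mA aeA) => u Au.
apply: ae_ge0_le_integral => //.
- by move=> w _; rewrite lee_fin.
- by apply/measurable_EFinP; exact: measurable_fun_pair1.
- by move=> w _; exact: Lnorm_ge0.
- by apply: filterS Au => w.
Qed.

End essential_bounds.

(** * Averaging posteriors of a random likelihood *)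

Section random_likelihood.
Context d d' (Om : measurableType d) (U : measurableType d') (R : realType).
Context (P : probability Om R) (lambda : probability U R).
Variables (l : U -> R) (lh : Om * U -> R) (C : R).
Hypothesis ml : measurable_fun setT l.
Hypothesis mlh : measurable_fun setT lh.
Hypothesis l01 : forall u, 0 < l u <= 1.
Hypothesis lh01 : forall x, 0 < lh x <= 1.
Hypothesis C_ge1 : 1 <= C.

Let Z := \int[lambda]_u l u.
Let Zh w := \int[lambda]_u lh (w, u).
(* The evidence is only almost surely bounded below. Truncating it at the lower
   bound makes every density below bounded everywhere and changes nothing
   almost surely. *)
Let Zc w := Num.max (Zh w) C^-1.
Let pc w u := lh (w, u) / Zc w.
Let a u := \int[P]_w pc w u.
Let D (x : Om * U) := (lh x - l x.2) ^+ 2.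

Hypothesis ZC : C^-1 <= Z.

Let C_gt0 : 0 < C. Proof. exact: lt_le_trans C_ge1. Qed.
Let lh_gt0 x : 0 < lh x. Proof. by case/andP: (lh01 x). Qed.
Let lh_le1 x : lh x <= 1. Proof. by case/andP: (lh01 x). Qed.
Let l_gt0 x : 0 < l x. Proof. by case/andP: (l01 x). Qed.
Let l_le1 x : l x <= 1. Proof. by case/andP: (l01 x). Qed.
Let lh_bound x : `|lh x| <= 1. Proof. by rewrite gtr0_norm. Qed.
Let l_bound x : `|l x| <= 1. Proof. by rewrite gtr0_norm. Qed.

Let mlhw w : measurable_fun setT (fun u => lh (w, u)).
Proof. exact: measurable_fun_pair2. Qed.

Let mlhu u : measurable_fun setT (fun w => lh (w, u)).
Proof. exact: measurable_fun_pair1. Qed.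

Let mZh : measurable_fun setT Zh.
Proof.
apply: (measurableT_comp (f := fine)) => //.
apply: (measurable_fun_fubini_tonelli_F (EFin \o lh)).
  exact/measurable_EFinP.
by move=> x; rewrite lee_fin ltW.
Qed.

Let mZc : measurable_fun setT Zc.
Proof. exact: measurable_maxr. Qed.

Let Zh_ge0 w : 0 <= Zh w.
Proof. by apply: Rintegral_ge0 => u _; exact: ltW. Qed.

Let Zh_le1 w : Zh w <= 1.
Proof.
rewrite -lee_fin -(Rintegral_EFin lambda (mlhw w) (fun u => lh_bound (w, u))).
rewrite -(integral_probability_cst lambda 1%E).
apply: ge0_le_integral => //.
- by move=> u _; rewrite lee_fin ltW.
- exact/measurable_EFinP.
- by move=> u _; rewrite lee_fin.
Qed.

Let Zc_gt0 w : 0 < Zc w.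
Proof. by rewrite lt_max invr_gt0 C_gt0 orbT. Qed.

Let Zc_le1 w : Zc w <= 1.
Proof. by rewrite ge_max Zh_le1 invf_le1. Qed.

Let ZcV_le w : (Zc w)^-1 <= C.
Proof. by rewrite invf_ple ?posrE// le_max lexx orbT. Qed.

Let mpc : measurable_fun setT (fun x => pc x.1 x.2).
Proof.
apply: measurable_funM.
  by rewrite (_ : (fun x => _) = lh)//; apply/funext => -[].
apply: (@measurableT_comp _ _ _ _ _ _ (fun w => (Zc w)^-1)) => //.
by apply: measurable_inv_ge0 => // w; exact: ltW.
Qed.

Let pc_ge0 w u : 0 <= pc w u.
Proof. by rewrite divr_ge0 ?ltW. Qed.

Let pc_bound w u : `|pc w u| <= C.
Proof.
rewrite ger0_norm// -[leRHS]mul1r ler_pM ?invr_ge0//; exact: ltW.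
Qed.

Let lh_le_pc w u : lh (w, u) <= pc w u.
Proof. by rewrite ler_pdivlMr// ler_piMr// ltW. Qed.

Let mpcu u : measurable_fun setT (pc ^~ u).
Proof. exact: (measurable_fun_pair1 u mpc). Qed.

Let mpcw w : measurable_fun setT (pc w).
Proof. exact: (measurable_fun_pair2 w mpc). Qed.

Let ma : measurable_fun setT a.
Proof.
apply: (measurableT_comp (f := fine)) => //.
apply: (measurable_fun_fubini_tonelli_G (fun x => (pc x.1 x.2)%:E)).
  exact/measurable_EFinP.
by move=> x; rewrite lee_fin.
Qed.

Let mD : measurable_fun setT D.
Proof.
apply: measurable_funX; apply: measurable_funB => //.
exact: measurableT_comp.
Qed.

Let mDe : measurable_fun setT (EFin \o D).
Proof. exact/measurable_EFinP. Qed.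

Let D_ge0 x : (0 <= (D x)%:E)%E.
Proof. by rewrite lee_fin sqr_ge0. Qed.

(* Replacing the random likelihood, then the random evidence, splits the error
   in two. Truncation at [C^-1] is 1-Lipschitz and fixes [Z], so the truncated
   evidence is no further from [Z] than [Zh w]. *)
Let pc_sub_sq w u : (pc w u - l u / Z) ^+ 2 <=
  2 * C ^+ 2 * D (w, u) + 2 * C ^+ 4 * (Zh w - Z) ^+ 2.
Proof.
have Z0 : 0 < Z by rewrite (lt_le_trans _ ZC)// invr_gt0.
have ZV : Z^-1 <= C by rewrite invf_ple ?posrE.
have E : pc w u - l u / Z =
   (lh (w, u) - l u) / Zc w + l u * (Z - Zc w) * (Zc w)^-1 * Z^-1.
  by rewrite /pc; field; rewrite !gt_eqF.
have maxL : (Z - Zc w) ^+ 2 <= (Zh w - Z) ^+ 2.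
  rewrite /Zc; move: (C^-1) Z (Zh w) ZC => c z h cz.
  by have [hc|hc] := leP h c; nra.
rewrite {}E (@le_trans _ _ (2 * ((lh (w, u) - l u) / Zc w) ^+ 2 +
    2 * (l u * (Z - Zc w) * (Zc w)^-1 * Z^-1) ^+ 2))//.
  set x := _ / _; set y := _ * _ * _ * _.
  by have := sqr_ge0 (x - y); nra.
rewrite -(mulrA 2 (C ^+ 2)) -(mulrA 2 (C ^+ 4)) lerD// ler_pM2l//.
  rewrite exprMn mulrC /D /= ler_wpM2r ?sqr_ge0//.
  by rewrite lerXn2r// nnegrE ?invr_ge0 ltW.
have l2 : l u ^+ 2 <= 1 by rewrite expr_le1// ltW.
have z2 : (Zc w)^-1 ^+ 2 <= C ^+ 2 by rewrite lerXn2r// nnegrE ?invr_ge0 ltW.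
have z3 : Z^-1 ^+ 2 <= C ^+ 2 by rewrite lerXn2r// nnegrE ?invr_ge0 ltW.
rewrite (_ : C ^+ 4 * _ = 1 * ((Zh w - Z) ^+ 2 * (C ^+ 2 * C ^+ 2)));
  last by ring.
rewrite (_ : (_ * _ * _ * _) ^+ 2 = l u ^+ 2 *
  ((Z - Zc w) ^+ 2 * ((Zc w)^-1 ^+ 2 * Z^-1 ^+ 2))); last by ring.
have zz : (Zc w)^-1 ^+ 2 * Z^-1 ^+ 2 <= C ^+ 2 * C ^+ 2.
  by apply: ler_pM => //; exact: sqr_ge0.
have zz0 : 0 <= (Zc w)^-1 ^+ 2 * Z^-1 ^+ 2.
  by apply: mulr_ge0; exact: sqr_ge0.
apply: ler_pM => //; first exact: sqr_ge0.
  by apply: mulr_ge0 => //; exact: sqr_ge0.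
by apply: ler_pM => //; exact: sqr_ge0.
Qed.

(* The evidence error is the prior mean of the likelihood error, and a squared
   mean is at most the mean of the square. *)
Let Zh_sub_sq w : (((Zh w - Z) ^+ 2)%:E <= \int[lambda]_u (D (w, u))%:E)%E.
Proof.
rewrite (_ : Zh w - Z = \int[lambda]_u (lh (w, u) - l u)); last first.
  rewrite RintegralB//.
    exact: (bounded_integrable lambda (mlhw w) (fun u => lh_bound (w, u))).
  exact: (bounded_integrable lambda ml l_bound).
apply: (sq_Rintegral_le lambda (B := 1 + 1)).
  exact: measurable_funB.
by move=> u; rewrite (le_trans (ler_normB _ _))// lerD.
Qed.

(** The error of the truncated posterior density is governed by that of the
    likelihood: the evidence, being a mean of the likelihood, has no larger
    mean-square error. *)
Lemma density_mean_square_error :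
  (\int[lambda]_u \int[P]_w ((pc w u - l u / Z) ^+ 2)%:E <=
   (2 * C ^+ 2 + 2 * C ^+ 4)%:E * \int[lambda]_u \int[P]_w (D (w, u))%:E)%E.
Proof.
have mS : measurable_fun setT
    (fun x : Om * U => ((pc x.1 x.2 - l x.2 / Z) ^+ 2)%:E).
  apply/measurable_EFinP; apply: measurable_funX; apply: measurable_funB => //.
  by apply: measurable_funM => //; exact: measurableT_comp.
have S0 (x : Om * U) : (0 <= ((pc x.1 x.2 - l x.2 / Z) ^+ 2)%:E)%E.
  by rewrite lee_fin sqr_ge0.
have c2 : 0 <= 2 * C ^+ 2 by rewrite mulr_ge0 ?sqr_ge0.
have c4 : 0 <= 2 * C ^+ 4 by rewrite mulr_ge0 ?exprn_ge0 ?ltW.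
have mDF :=
  measurable_fun_fubini_tonelli_F (m2 := lambda) (EFin \o D) mDe D_ge0.
have DF0 w : (0 <= \int[lambda]_u (D (w, u))%:E)%E by exact: integral_ge0.
rewrite -(fubini_tonelli (m1 := P) (m2 := lambda) _ mS S0).
rewrite -(fubini_tonelli (m1 := P) (m2 := lambda) _ mDe D_ge0).
rewrite -ge0_integralZl_EFin ?addr_ge0//; last by move=> w _; exact: DF0.
apply: ge0_le_integral => //=.
- by move=> w _; apply: integral_ge0 => u _; exact: (S0 (w, u)).
- exact: (measurable_fun_fubini_tonelli_F (m2 := lambda) _ mS S0).
- exact: measurable_funeM.
move=> w _; apply: (@le_trans _ _ (\int[lambda]_u
    ((2 * C ^+ 2)%:E * (D (w, u))%:E + (2 * C ^+ 4 * (Zh w - Z) ^+ 2)%:E))%E).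
  apply: ge0_le_integral => //=.
  - by move=> u _; exact: (S0 (w, u)).
  - exact: (measurable_fun_pair2 w mS).
  - apply: emeasurable_funD => //; apply: measurable_funeM.
    exact: (measurable_fun_pair2 w mDe).
  - by move=> u _; rewrite -EFinM -EFinD lee_fin pc_sub_sq.
rewrite ge0_integralD//; last 3 first.
- by move=> u _; rewrite mule_ge0.
- by apply: measurable_funeM; exact: (measurable_fun_pair2 w mDe).
- by move=> u _; rewrite lee_fin mulr_ge0 ?sqr_ge0.
rewrite integral_probability_cst ge0_integralZl_EFin//; last first.
  exact: (measurable_fun_pair2 w mDe).
rewrite EFinD ge0_muleDl//; apply: leeD2l.
by rewrite (EFinM (2 * C ^+ 4)); exact: lee_wpmul2l.
Qed.

Variables (B : R) (M : nat).
Hypothesis B_gt0 : 0 < B.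
Hypothesis M_gt0 : (0 < M)%N.
Hypothesis ZhC : {ae P, forall w, C^-1 <= Zh w}.
Hypothesis inv_lh_bound : {ae iid P M, forall ws,
  (Order.min
    (\int[P]_w 'N[lambda]_+oo[(fun u => ((lh (w, u))^-1)%:E)])
    ('N[lambda]_+oo[(fun u => (sample_mean (fun w => (lh (w, u))^-1) ws)%:E)])
   <= B%:E)%E}.
Variables (mu_a : probability U R) (mu_s : Om -> probability U R).
Hypothesis mu_aE :
  has_density lambda mu_a (fun u => \int[P]_w (lh (w, u) / Zh w)%:E)%E.
Hypothesis mu_sE : forall w,
  has_density lambda (mu_s w) (fun u => (lh (w, u) / Zh w)%:E).

Let aM (ws : M.-tuple Om) u := sample_mean (fun w => pc w u) ws.

Let sample_mean_ge0 (f : Om -> R) (ws : M.-tuple Om) :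
  (forall w, 0 <= f w) -> 0 <= sample_mean f ws.
Proof. by move=> f0; rewrite mulr_ge0 ?invr_ge0// sumr_ge0. Qed.

Let maM : measurable_fun setT (fun x => aM x.1 x.2).
Proof.
apply: measurable_funM => //; apply: measurable_sum => i.
apply: (@measurableT_comp _ _ _ _ _ _ (fun x => pc x.1 x.2) _
  (fun x => (tnth x.1 i, x.2))) => //.
apply: measurable_fun_pair => //.
exact: (measurableT_comp (measurable_tnth i) measurable_fst).
Qed.

Let a_ge0 u : 0 <= a u.
Proof. by apply: Rintegral_ge0 => w _. Qed.

Let mh w : measurable_fun setT (fun u => lh (w, u) / Zh w).
Proof. exact: measurable_funM. Qed.

Let mu_a_density : has_density lambda mu_a (EFin \o a).
Proof.
rewrite (_ : EFin \o a = (fun u => \int[P]_w (lh (w, u) / Zh w)%:E)%E)//.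
apply/funext => u /=.
rewrite -(Rintegral_EFin P (mpcu u) (fun w => pc_bound w u)).
apply: ae_eq_integral => //.
- exact/measurable_EFinP.
- apply/measurable_EFinP; apply: measurable_funM => //.
  by apply: measurable_inv_ge0.
- by apply: filterS ZhC => w Zw _; rewrite /pc /Zc max_l.
Qed.

(* The distance must be measurable in the sample everywhere, exceptional samples
   included, so the density without truncation is needed beside [aM]. *)
Let aR (ws : M.-tuple Om) u := sample_mean (fun w => lh (w, u) / Zh w) ws.

Let maR : measurable_fun setT (fun x => aR x.1 x.2).
Proof.
apply: measurable_funM => //; apply: measurable_sum => i.
apply: (@measurableT_comp _ _ _ _ _ _ (fun x => lh x / Zh x.1) _
  (fun x => (tnth x.1 i, x.2))) => //.
  apply: measurable_funM => //.
  apply: (@measurableT_comp _ _ _ _ _ _ (fun w => (Zh w)^-1)) => //.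
  exact: measurable_inv_ge0.
apply: measurable_fun_pair => //.
exact: (measurableT_comp (measurable_tnth i) measurable_fst).
Qed.

Let hellingerE ws :
  (hellinger lambda mu_a (average_measure mu_s ws) ^+ 2 =
   2^-1%:E * \int[lambda]_u ((Num.sqrt (a u) - Num.sqrt (aR ws u)) ^+ 2)%:E)%E.
Proof.
apply: hellinger_has_density => //.
  exact: (measurable_fun_pair2 ws maR).
apply: (average_has_density (p := fun w u => lh (w, u) / Zh w)) => // w u.
by rewrite divr_ge0// ltW.
Qed.

Let aRE : {ae iid P M, forall ws, aR ws = aM ws}.
Proof.
apply: filterS (ae_iid M ZhC) => ws wsC; apply/funext => u.
congr (_ * _); apply: eq_bigr => i _.
by rewrite /pc /Zc max_l.
Qed.

Let inv_lh_ge0 x : 0 <= (lh x)^-1.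
Proof. by rewrite invr_ge0 ltW. Qed.

(* The first argument of the minimum is deterministic. If it realizes the bound,
   the harmonic-arithmetic mean inequality over the law of the draw bounds [a]
   below; otherwise the same inequality over the sample bounds [aM ws]. Since
   [Zc w <= 1], likelihoods are lower bounds of the densities. *)
Let density_lower_bound : {ae iid P M, forall ws, {ae lambda, forall u,
  B^-1 <= a u \/ B^-1 <= aM ws u}}.
Proof.
have mV : measurable_fun setT (fun x => (lh x)^-1).
  by apply: measurable_inv_ge0 => // x; exact: ltW.
apply: filterS inv_lh_bound => ws; rewrite ge_min => /orP[hA|hB].
  apply: filterS (ae_integral_le_Lnorm_infty P lambda mV inv_lh_ge0) => u hu.
  left.
  apply: (@le_trans _ _ (\int[P]_w lh (w, u))).
    by apply: Rintegral_ge_of_inv => //; exact: le_trans hu hA.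
  apply: le_Rintegral => //.
  - exact: (bounded_integrable P (mlhu u) (fun w => lh_bound (w, u))).
  - exact: (bounded_integrable P (mpcu u) (fun w => pc_bound w u)).
move/Lnorm_infty_leP : hB; apply: filterS => u hu; right.
apply: (@le_trans _ _ (sample_mean (fun w => lh (w, u)) ws)).
  apply: sample_mean_ge_of_inv => //.
  by rewrite -lee_fin (le_trans _ hu)//= lee_fin ler_norm.
by rewrite ler_wpM2l ?invr_ge0// ler_sum.
Qed.

(** A lower bound on one of the two densities turns the Hellinger distance into
    a mean-square distance, whose expectation over the sample is a variance. *)
Theorem hellinger_average_posterior_le :
  (\int[iid P M]_ws (hellinger lambda mu_a (average_measure mu_s ws) ^+ 2) <=
   (B * (C ^+ 2 + C ^+ 4) / M%:R)%:E *
     \int[lambda]_u \int[P]_w (D (w, u))%:E)%E.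
Proof.
pose H (x : M.-tuple Om * U) :=
  ((Num.sqrt (a x.2) - Num.sqrt (aR x.1 x.2)) ^+ 2)%:E.
pose V (x : M.-tuple Om * U) := ((a x.2 - aM x.1 x.2) ^+ 2)%:E.
have H0 x : (0 <= H x)%E by rewrite lee_fin sqr_ge0.
have V0 x : (0 <= V x)%E by rewrite lee_fin sqr_ge0.
have mH : measurable_fun setT H.
  apply/measurable_EFinP; apply: measurable_funX; apply: measurable_funB.
    by apply: measurable_fun_sqrt; exact: measurableT_comp.
  exact: measurable_fun_sqrt.
have mV : measurable_fun setT V.
  apply/measurable_EFinP; apply: measurable_funX; apply: measurable_funB => //.
  exact: measurableT_comp ma measurable_snd.
have HF0 ws : (0 <= \int[lambda]_u H (ws, u))%E by exact: integral_ge0.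
have VF0 ws : (0 <= \int[lambda]_u V (ws, u))%E by exact: integral_ge0.
have mHF := measurable_fun_fubini_tonelli_F (m2 := lambda) H mH H0.
have mVF := measurable_fun_fubini_tonelli_F (m2 := lambda) V mV V0.
under eq_integral => ws _ do rewrite hellingerE.
apply: (@le_trans _ _
  (\int[iid P M]_ws ((2^-1 * B)%:E * \int[lambda]_u V (ws, u)))%E).
  apply: ae_ge0_le_integral => //.
  - by move=> ws _; rewrite mule_ge0 ?lee_fin ?invr_ge0//; exact: HF0.
  - exact: measurable_funeM mHF.
  - by move=> ws _; rewrite mule_ge0 ?lee_fin ?mulr_ge0 ?invr_ge0 ?(ltW B_gt0).
  - exact: measurable_funeM mVF.
  apply: filterS2 aRE density_lower_bound => ws -> aeb _.
  rewrite EFinM -muleA lee_wpmul2l ?lee_fin ?invr_ge0//.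
  rewrite -ge0_integralZl_EFin ?(ltW B_gt0)//; last first.
    exact: (measurable_fun_pair2 ws mV).
  apply: ae_ge0_le_integral => //.
  - by move=> u _; rewrite lee_fin sqr_ge0.
  - apply/measurable_EFinP; apply: measurable_funX; apply: measurable_funB.
      exact: measurable_fun_sqrt.
    apply: measurable_fun_sqrt.
    exact: (measurable_fun_pair2 ws maM).
  - by move=> u _; rewrite mule_ge0 ?lee_fin ?(ltW B_gt0)//; exact: V0.
  - by apply: measurable_funeM; exact: (measurable_fun_pair2 ws mV).
  apply: filterS aeb => u hu _; rewrite -EFinM lee_fin /=.
  have := sqrt_diff_sq_le _ (a_ge0 u)
    (sample_mean_ge0 ws (fun w => pc_ge0 w u)) hu.
  by rewrite invrK; apply; rewrite invr_gt0.
rewrite ge0_integralZl_EFin//; last first.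
  by rewrite mulr_ge0// ?invr_ge0// ltW.
rewrite (fubini_tonelli (m1 := iid P M) (m2 := lambda) V mV V0).
apply: (@le_trans _ _ ((2^-1 * B)%:E * (M%:R^-1%:E *
    \int[lambda]_u \int[P]_w ((pc w u - l u / Z) ^+ 2)%:E))%E).
  apply: lee_wpmul2l; first by rewrite lee_fin mulr_ge0// ?invr_ge0// ltW.
  have mS : measurable_fun setT
      (fun x : Om * U => ((pc x.1 x.2 - l x.2 / Z) ^+ 2)%:E).
    apply/measurable_EFinP; apply: measurable_funX.
    apply: measurable_funB => //.
    by apply: measurable_funM => //; exact: measurableT_comp.
  have S0 (x : Om * U) : (0 <= ((pc x.1 x.2 - l x.2 / Z) ^+ 2)%:E)%E.
    by rewrite lee_fin sqr_ge0.
  have SG0 u : (0 <= \int[P]_w ((pc w u - l u / Z) ^+ 2)%:E)%E.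
    by apply: integral_ge0 => w _; exact: (S0 (w, u)).
  have mSG := measurable_fun_fubini_tonelli_G (m1 := P) _ mS S0.
  rewrite -ge0_integralZl_EFin ?invr_ge0//.
  apply: ge0_le_integral => //.
  - by move=> u _; apply: integral_ge0.
  - exact: measurable_fun_fubini_tonelli_G.
  - exact: measurable_funeM mSG.
  move=> u _.
  exact: (sample_mean_variance P (l u / Z) M_gt0 (mpcu u)
    (fun w => pc_bound w u)).
rewrite muleA -EFinM.
apply: (@le_trans _ _ ((2^-1 * B * M%:R^-1)%:E * ((2 * C ^+ 2 + 2 * C ^+ 4)%:E *
    \int[lambda]_u \int[P]_w (D (w, u))%:E))%E).
  apply: lee_wpmul2l density_mean_square_error.
  by rewrite lee_fin !mulr_ge0 ?invr_ge0// ltW.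
rewrite muleA -EFinM lee_wpmul2r//.
  by apply: integral_ge0 => u _; exact: integral_ge0.
rewrite lee_fin le_eqVlt; apply/orP; left; apply/eqP.
by field; rewrite pnatr_eq0 -lt0n.
Qed.

End random_likelihood.

(** * Gaussian likelihoods *)

Lemma continuous_borel_measurable (R : realType) (V : normedModType R)
    (f : V -> R) : continuous f -> measurable_fun setT (f : borel V -> R).
Proof.
move=> /continuousP cf; apply: (measurability _ (RGenOpens.measurableE R)).
move=> _ [_ [a [b ->] <-]]; rewrite setTI; apply: sub_sigma_algebra.
exact/cf/interval_open.
Qed.

Section sqrte_square.
Variable R : realType.
Local Open Scope ereal_scope.

Lemma le_sq_of_sqrte_le (x : \bar R) (r : R) :
  0 <= x -> sqrte x <= r%:E -> x <= (r ^+ 2)%:E.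
Proof.
move=> x0 xr; rewrite -(sqr_sqrte x0) EFin_expe !expe2.
by apply: lee_pmul => //; exact: sqrte_ge0.
Qed.

Lemma sqrte_le_of_le_sq (x : \bar R) (r : R) :
  (0 <= r)%R -> x <= (r ^+ 2)%:E -> sqrte x <= r%:E.
Proof.
move=> r0 xr; rewrite -[leRHS]gee0_abs ?lee_fin// -sqrte_sqr -EFin_expe.
by rewrite lee_sqrt// lee_fin sqr_ge0.
Qed.

End sqrte_square.

Section potential.
Variables (R : realType) (X Y : normedModType R) (S : {linear Y -> Y}) (K : R).
Hypothesis SK : forall y, `|S y| <= K * `|y|.

Lemma bounded_linear_norm_continuous (y : Y) :
  continuous (fun v : Y => `|S (y - v)|).
Proof.
have cS : continuous S.
  apply/linear_bounded_continuous/linear_boundedP; exists K; split.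
    exact: num_real.
  move=> r Kr x; apply: le_trans (SK x) _.
  by rewrite ler_wpM2r// ltW.
move=> v; apply: (@continuous_comp _ _ _ (fun v => S (y - v)) (fun v => `|v|)).
  apply: (@continuous_comp _ _ _ (fun v => y - v) S); last exact: cS.
  by apply: cvgB; [exact: cvg_cst|exact: cvg_id].
exact: norm_continuous.
Qed.

(** Working with the bounded likelihood [exp (- Phi)] rather than with [Phi]
    makes the dependence on the forward map globally Lipschitz. *)
Lemma expR_potential_lipschitz (y : Y) (g g' : X -> Y) (u : X) :
  `|expR (- potential S y g u) - expR (- potential S y g' u)| <=
  K * `|g' u - g u|.
Proof.
apply: le_trans (expR_half_sq_lipschitz (normr_ge0 _) (normr_ge0 _)) _.
apply: le_trans (ler_dist_dist _ _) _.
by rewrite -linearB opprB addrC addrA subrK; exact: SK.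
Qed.

End potential.

Theorem theorem3p3 (R : realType) (X Y : completeNormedModType R)
  (hdimY : finite_dimensional Y)
  (* prior *)
  (m0 : X) (C0 : (X -> R) -> X) (mu0 : probability (borel X) R)
  (hmu0 : gaussian mu0 m0 C0)
  (* noise covariance *)
  (ip : {dot Y for idfun}) (Gam Gam_inv_sqrt : {linear Y -> Y})
  (hGam : covariance_op ip Gam) (hGam_nonsing : bijective Gam)
  (hGam_inv_sqrt : inverse_sqrt_op ip Gam Gam_inv_sqrt)
  (* observation and forward maps *)
  (y : Y) (G : X -> Y)
  (hG : measurable_fun setT (G : borel X -> borel Y))
  (d : measure_display) (Omega : measurableType d)
  (nu : R -> probability Omega R) (Gh : R -> Omega -> X -> Y)
  (hGh : forall h : R, 0 < h ->
     measurable_fun setT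
       ((fun p => Gh h p.1 p.2) : Omega * borel X -> borel Y))
  (s : R) (hs : 0 < s) (hmso : mean_square_order mu0 nu G Gh s) :
  let Phi := potential Gam_inv_sqrt y G in
  let Phih h w := potential Gam_inv_sqrt y (Gh h w) in
  let Zh h w := evidence mu0 (Phih h w) in
  forall
  (hbnd : boundedness mu0 nu Phi Phih)
  (* averaged posterior, and posterior given one draw w *)
  (mu_a : R -> probability (borel X) R)
  (hmu_a : forall h : R, 0 < h ->
     has_density mu0 (mu_a h)
       (fun u => \int[nu h]_w (expR (- Phih h w u) / Zh h w)%:E)%E)
  (mu_s : R -> Omega -> probability (borel X) R)
  (hmu_s : forall (h : R) (w : Omega), 0 < h ->
     has_density mu0 (mu_s h w) (fun u => (expR (- Phih h w u) / Zh h w)%:E)),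
  exists2 C : R, 0 < C &
    forall (h : R) (M : nat), 0 < h -> (0 < M)%N ->
      (sqrte (\int[iid (nu h) M]_ws
         (hellinger mu0 (mu_a h) (average_measure (mu_s h) ws) ^+ 2))
       <= (C * (h `^ s / Num.sqrt M%:R))%:E)%E.
Proof.
move=> Phi Phih Zh hbnd mu_a hmu_a mu_s hmu_s.
have [K K0 SK] := finite_dimensional_linear_bounded Gam_inv_sqrt hdimY.
have cN := bounded_linear_norm_continuous SK.
have [Cm Cm0 Gerr] := hmso.
have [C1 [C2 [C3 [C4 [[C10 C20 C30 C40] hexp /andP[hZ _] hZh _]]]]] := hbnd.
(* One constant for both evidence bounds. Having [C^-1 <= 1] keeps the truncated
   evidence at most [1]. *)
pose C := Num.max 1 (Num.max C2 C3).
have C_ge1 : 1 <= C by rewrite le_max lexx.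
have C_gt0 : 0 < C by exact: lt_le_trans C_ge1.
have CV2 : C^-1 <= C2^-1 by rewrite lef_pV2 ?posrE// !le_max lexx orbT.
have CV3 : C^-1 <= C3^-1 by rewrite lef_pV2 ?posrE// !le_max lexx !orbT.
pose A := C1 * (C ^+ 2 + C ^+ 4).
have A_gt0 : 0 < A by rewrite mulr_gt0// addr_gt0 ?exprn_gt0.
exists (Num.sqrt A * (K * Cm)); first by rewrite !mulr_gt0 ?sqrtr_gt0.
move=> h M h0 M0.
pose l u := expR (- Phi u).
pose lh x := expR (- Phih h x.1 x.2).
have pot_ge0 (g : X -> Y) u : 0 <= potential Gam_inv_sqrt y g u.
  by rewrite mulr_ge0 ?invr_ge0 ?sqr_ge0.
have mexp d' (T : measurableType d') (g : T -> Y) :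
    measurable_fun setT (g : T -> borel Y) ->
    measurable_fun setT
      (fun x => expR (- (2^-1 * `|Gam_inv_sqrt (y - g x)| ^+ 2)) : R).
  move=> mg; apply: measurableT_comp; first exact: measurable_expR.
  apply: measurable_funN; apply: measurable_funM => //; apply: measurable_funX.
  exact: (measurableT_comp (continuous_borel_measurable (cN y)) mg).
have ml : measurable_fun setT (l : borel X -> R) by exact: mexp hG.
have mlh : measurable_fun setT (lh : Omega * borel X -> R).
  exact: mexp (hGh h h0).
have l01 u : 0 < l u <= 1 by rewrite expR_gt0 expR_le1 oppr_le0 pot_ge0.
have lh01 x : 0 < lh x <= 1 by rewrite expR_gt0 expR_le1 oppr_le0 pot_ge0.
have ZC : C^-1 <= \int[mu0]_u l u by exact: le_trans hZ.
have ZhC : {ae nu h, forall w, C^-1 <= \int[mu0]_u lh (w, u)}.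
  by apply: filterS (hZh h h0) => w /andP[+ _]; exact: le_trans.
have lhV w u : (lh (w, u))^-1 = expR (Phih h w u) by rewrite -expRN opprK.
have inv_lh : {ae iid (nu h) M, forall ws, (Order.min
    (\int[nu h]_w 'N[mu0]_+oo[(fun u => ((lh (w, u))^-1)%:E)])
    ('N[mu0]_+oo[(fun u => (sample_mean (fun w => (lh (w, u))^-1) ws)%:E)])
   <= C1%:E)%E}.
  apply: filterS (hexp h M h0 M0) => ws.
  apply: le_trans; rewrite le_eqVlt; apply/orP; left; apply/eqP.
  congr (Order.min _ _).
    by apply: eq_integral => w _; apply: eq_Lnorm => u; rewrite lhV.
  apply: eq_Lnorm => u; congr (_ * _)%:E; apply: eq_bigr => i _.
  exact: lhV.
have := hellinger_average_posterior_le ml mlh l01 lh01 C_ge1 ZC C10 M0 ZhC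
  inv_lh (hmu_a h h0) (fun w => hmu_s h w h0).
rewrite -/A => main.
have err : (\int[mu0]_u \int[nu h]_w ((lh (w, u) - l u) ^+ 2)%:E <=
    ((K * (Cm * h `^ s)) ^+ 2)%:E)%E.
  have mS : measurable_fun setT
      (fun x : Omega * borel X => ((lh x - l x.2) ^+ 2)%:E).
    apply/measurable_EFinP; apply: measurable_funX.
    apply: measurable_funB => //.
    exact: measurableT_comp.
  rewrite -(integral_probability_cst mu0 ((K * (Cm * h `^ s)) ^+ 2)%:E).
  apply: ae_ge0_le_integral => //.
  - by move=> u _; apply: integral_ge0 => w _; rewrite lee_fin sqr_ge0.
  - apply: (measurable_fun_fubini_tonelli_G _ mS) => x.
    by rewrite lee_fin sqr_ge0.
  - by move=> u _; rewrite lee_fin sqr_ge0.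
  refine (@filterS _ _ (ae_filter_ringOfSetsType mu0) _ _ _ (Gerr h h0)).
  move=> u /le_sq_of_sqrte_le Gu _.
  have mGh : measurable_fun setT (fun w => (`|G u - Gh h w u| ^+ 2)%:E).
    apply/measurable_EFinP; apply: measurable_funX.
    apply: (measurableT_comp (f := fun v : borel Y => `|G u - v|)).
      apply: continuous_borel_measurable => v.
      apply: (@continuous_comp _ _ _ (fun v => G u - v) (fun v => `|v|)).
        by apply: cvgB; [exact: cvg_cst|exact: cvg_id].
      exact: norm_continuous.
    exact: (measurable_fun_pair1 u (hGh h h0)).
  apply: (@le_trans _ _
    (\int[nu h]_w ((K ^+ 2)%:E * (`|G u - Gh h w u| ^+ 2)%:E))%E).
    apply: ge0_le_integral => //.
    - by move=> w _; rewrite lee_fin sqr_ge0.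
    - exact: (measurable_fun_pair1 u mS).
    - exact: measurable_funeM.
    move=> w _; rewrite -EFinM lee_fin -exprMn -real_normK ?num_real//.
    rewrite lerXn2r ?nnegrE ?mulr_ge0 ?(ltW K0)//.
    exact: expR_potential_lipschitz.
  rewrite ge0_integralZl_EFin ?sqr_ge0//.
  rewrite [X in (_ <= X%:E)%E]exprMn [leRHS]EFinM.
  apply: lee_wpmul2l; first by rewrite lee_fin sqr_ge0.
  apply: Gu.
  by apply: integral_ge0 => w _; rewrite lee_fin sqr_ge0.
apply: sqrte_le_of_le_sq.
  by rewrite !mulr_ge0 ?sqrtr_ge0 ?invr_ge0 ?sqrtr_ge0 ?powR_ge0 ?ltW.
apply: le_trans main _.
apply: le_trans (lee_wpmul2l _ err) _.
  by rewrite lee_fin divr_ge0// ltW.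
rewrite -EFinM lee_fin.
rewrite (_ : (Num.sqrt A * (K * Cm) * (h `^ s / Num.sqrt M%:R)) ^+ 2 =
  Num.sqrt A ^+ 2 * (Num.sqrt M%:R)^-1 ^+ 2 * (K * (Cm * h `^ s)) ^+ 2).
  by rewrite exprVn !sqr_sqrtr ?ler0n ?(ltW A_gt0).
ring.
Qed.
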